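(* Let $R$ be a ring, let $\mathcal{X}$ be a class of right $R$-modules closed under isomorphisms, and let $M$ be a right $R$-module with an epimorphic $\mathcal{X}$-cover $p:X\to M$ such that $\mathrm{End}(X)/J(\mathrm{End}(X))$ is a von Neumann regular right self-injective ring and idempotents lift modulo $J(\mathrm{End}(X))$. If $M$ is $\mathcal{X}$-automorphism-coinvariant, then $M$ satisfies the finite exchange property.
   Context: Rings are associative with identity, modules are unital right modules, $J(-)$ is the Jacobson radical. An $\mathcal{X}$-precover of $M$ is a homomorphism $p:X\to M$ with $X\in\mathcal{X}$ such that every homomorphism $X'\to M$ with $X'\in\mathcal{X}$ factors through $p$. It is an $\mathcal{X}$-cover if, moreover, every endomorphism $h$ of $X$ with $p\circ h=p$ is an automorphism; it is epimorphic if $p$ is an epimorphism. $M$ is $\mathcal{X}$-automorphism-coinvariant if there is an $\mathcal{X}$-cover $p:X\to M$ such that for every automorphism $g$ of $X$ there is an endomorphism $f$ of $M$ with $f\circ p=p\circ g$. A right $R$-module $M$ has the (full) exchange property if for every right $R$-module $A$ and any two direct sum decompositions $A=M'\oplus N=\bigoplus_{i\in I}A_i$ with $M'\cong M$ there are submodules $B_i\subseteq A_i$ with $A=M'\oplus\bigl(\bigoplus_{i\in I}B_i\bigr)$; it has the finite exchange property if this holds for all finite index sets $I$. *)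

(* Defs.v *)
From HB Require Import structures.
From mathcomp Require Import all_boot all_order all_algebra all_classical.

Set Implicit Arguments.
Unset Strict Implicit.
Unset Printing Implicit Defensive.

Import GRing.Theory.

Local Open Scope ring_scope.
Local Open Scope quotient_scope.

(* MathComp Algebra only has left modules.  A right R-module is a left module
   over the converse ring R^c, where r *: x stands for x r. Rings may be zero
   (pzRingType), since End(M) is a zero ring when M = 0.
   The definitions on modules below are for an arbitrary lmodType S, and are
   used with S := R^c. Subsets are boolean predicates: with the classical
   axioms of boolp, every Prop-valued predicate is of this form. *)
Notation rmodType R := (lmodType R^c).

Section RingNotions.
Variable R : pzRingType.
Implicit Types (I K : {pred R}) (a b : R).

(* Right ideals are the submodules of the right regular module (R^c)^o,
   in which r *: x is the product x * r of R. *)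
Definition right_ideal I := GRing.submod_closed (I : {pred (R^c)^o}).

Definition maximal_right_ideal I :=
  [/\ right_ideal I, 1 \notin I &
      forall K, right_ideal K -> {subset I <= K} -> 1 \notin K ->
        {subset K <= I}].

Definition jacobson : {pred R} :=
  fun a => `[< forall I, maximal_right_ideal I -> a \in I >].

Definition von_neumann_regular := forall a, exists b, a = a * b * a.

Lemma jacobsonP a :
  reflect (forall I, maximal_right_ideal I -> a \in I) (a \in jacobson).
Proof. exact: asboolP. Qed.

Lemma right_idealP I :
  right_ideal I <->
  0 \in I /\ forall a u v : R, u \in I -> v \in I -> u * a + v \in I.
Proof. by []. Qed.

Lemma right_ideal0 I : right_ideal I -> 0 \in I. Proof. by case. Qed.

Lemma right_idealMD I (iI : right_ideal I) a u v :
  u \in I -> v \in I -> u * a + v \in I.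
Proof. by have /right_idealP[_] := iI; apply. Qed.

Lemma right_idealD I (iI : right_ideal I) u v :
  u \in I -> v \in I -> u + v \in I.
Proof. by move=> uI vI; rewrite -[u]mulr1; apply: right_idealMD. Qed.

Lemma right_idealM I (iI : right_ideal I) u a : u \in I -> u * a \in I.
Proof.
by move=> uI; rewrite -[_ * _]addr0; apply: right_idealMD => //;
  apply: right_ideal0.
Qed.

Lemma right_idealB I (iI : right_ideal I) u v :
  u \in I -> v \in I -> u - v \in I.
Proof.
move=> uI vI; rewrite addrC -[- v]mulr1 mulNr -mulrN.
exact: right_idealMD.
Qed.

Lemma jacobson_right_ideal : right_ideal jacobson.
Proof.
apply/right_idealP; split=> [|a u v /jacobsonP uJ /jacobsonP vJ]; apply/jacobsonP => I mI.
  by apply: right_ideal0; case: mI.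
by apply: right_idealMD; [case: mI|apply: uJ|apply: vJ].
Qed.

Lemma jacobson_mulr a b : a \in jacobson -> a * b \in jacobson.
Proof. exact: (right_idealM jacobson_right_ideal). Qed.

Lemma jacobson_mull a b : b \in jacobson -> a * b \in jacobson.
Proof.
move=> /jacobsonP bJ; apply/jacobsonP => I mI; have [iI I1 Imax] := mI.
have [aI|aI] := boolP (a \in I); first exact: right_idealM.
pose I' : {pred R} := fun x => a * x \in I.
have inI' x : (x \in I') = (a * x \in I) by [].
rewrite -inI'; apply: bJ; split; last 1 first.
- move=> K iK sI'K K1 k kK; rewrite inI'; apply: contraNT K1 => akI.
  pose L : {pred R} :=
    fun x => `[< exists2 y, y \in K & x - a * y \in I >].
  have LP x : reflect (exists2 y, y \in K & x - a * y \in I) (x \in L).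
    exact: asboolP.
  have iL : right_ideal L.
    apply/right_idealP; split=> [|r u v /LP[y yK uI] /LP[z zK vI]]; apply/LP.
      by exists 0; [exact: right_ideal0|rewrite mulr0 subr0 right_ideal0].
    exists (y * r + z); first exact: right_idealMD.
    have -> : u * r + v - a * (y * r + z) = (u - a * y) * r + (v - a * z).
      by rewrite mulrDr opprD mulrA addrACA mulrBl.
    exact: right_idealMD.
  have sIL : {subset I <= L}.
    by move=> x xI; apply/LP; exists 0; rewrite ?right_ideal0 ?mulr0 ?subr0.
  have akL : a * k \in L by apply/LP; exists k; rewrite ?subrr ?right_ideal0.
  have L1 : 1 \in L by apply: contraNT akI => L1; apply: (Imax L).
  have /LP[y yK ayI] : a \in L by rewrite -[a]mul1r right_idealM.
  rewrite -[1](subrK y); apply: right_idealD => //; apply: sI'K.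
  by rewrite inI' mulrBr mulr1.
- apply/right_idealP; split=> [|r u v]; first by rewrite inI' mulr0 right_ideal0.
  rewrite !inI' => uI vI.
  by rewrite mulrDr mulrA right_idealMD.
- by rewrite inI' mulr1.
Qed.

Lemma jacobson_zmod_closed : zmod_closed jacobson.
Proof.
split; first exact: (right_ideal0 jacobson_right_ideal).
exact: (right_idealB jacobson_right_ideal).
Qed.

HB.instance Definition _ :=
  GRing.isZmodClosed.Build R jacobson jacobson_zmod_closed.

(* MathComp makes {quot I} a ring only for proper ideals of commutative rings,
   so only its additive structure is used here. *)
Definition quotJ := Quotient.quot (jacobson : zmodClosed R).

HB.instance Definition _ := GRing.Zmodule.on quotJ.
HB.instance Definition _ :=
  EqQuotient.copy quotJ (Quotient.quot (jacobson : zmodClosed R)).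

Definition modJ (a : R) : quotJ := \pi_quotJ a.

Lemma modJ_eq a b : (modJ a = modJ b) <-> (a - b \in jacobson).
Proof.
by split=> [/eqP|ab]; [|apply/eqP]; rewrite /modJ -Quotient.idealrBE.
Qed.

Lemma modJ_surj (u : quotJ) : exists a, modJ a = u.
Proof. by exists (repr u); rewrite /modJ reprK. Qed.

Definition quotJ_one : quotJ := modJ 1.
Definition quotJ_mul (u v : quotJ) : quotJ := modJ (repr u * repr v).

Lemma modJ_mul a b : modJ (a * b) = quotJ_mul (modJ a) (modJ b).
Proof.
apply/modJ_eq; set a' := repr _; set b' := repr _.
have aJ : a - a' \in jacobson by apply/modJ_eq; rewrite /modJ reprK.
have bJ : b - b' \in jacobson by apply/modJ_eq; rewrite /modJ reprK.
have -> : a * b - a' * b' = (a - a') * b + a' * (b - b').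
  by rewrite mulrBl mulrBr addrA subrK.
by apply: rpredD; [exact: jacobson_mulr|exact: jacobson_mull].
Qed.

Lemma modJ_add a b : modJ (a + b) = modJ a + modJ b.
Proof. exact: Quotient.pi_add. Qed.

Lemma quotJ_mulA : associative quotJ_mul.
Proof.
move=> u v w; have [[a <-] [b <-] [c <-]] :=
  And3 (modJ_surj u) (modJ_surj v) (modJ_surj w).
by rewrite -!modJ_mul mulrA.
Qed.

Lemma quotJ_mul1r : left_id quotJ_one quotJ_mul.
Proof. by move=> u; have [a <-] := modJ_surj u; rewrite -modJ_mul mul1r. Qed.

Lemma quotJ_mulr1 : right_id quotJ_one quotJ_mul.
Proof. by move=> u; have [a <-] := modJ_surj u; rewrite -modJ_mul mulr1. Qed.

Lemma quotJ_mulDl : left_distributive quotJ_mul +%R.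
Proof.
move=> u v w; have [[a <-] [b <-] [c <-]] :=
  And3 (modJ_surj u) (modJ_surj v) (modJ_surj w).
by rewrite -modJ_add -!modJ_mul mulrDl modJ_add.
Qed.

Lemma quotJ_mulDr : right_distributive quotJ_mul +%R.
Proof.
move=> u v w; have [[a <-] [b <-] [c <-]] :=
  And3 (modJ_surj u) (modJ_surj v) (modJ_surj w).
by rewrite -modJ_add -!modJ_mul mulrDr modJ_add.
Qed.

HB.instance Definition _ := GRing.Zmodule_isPzRing.Build quotJ
  quotJ_mulA quotJ_mul1r quotJ_mulr1 quotJ_mulDl quotJ_mulDr.

Lemma modJ_is_zmod_morphism : zmod_morphism modJ.
Proof.
by move=> a b; apply: (addIr (modJ b)); rewrite -modJ_add !subrK.
Qed.

Lemma modJ_is_monoid_morphism : monoid_morphism modJ.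
Proof. by split=> // a b; exact: modJ_mul. Qed.

HB.instance Definition _ :=
  GRing.isZmodMorphism.Build R quotJ modJ modJ_is_zmod_morphism.
HB.instance Definition _ :=
  GRing.isMonoidMorphism.Build R quotJ modJ modJ_is_monoid_morphism.

Definition idempotents_lift_modJ :=
  forall u : quotJ, u * u = u -> exists2 e : R, e * e = e & modJ e = u.

End RingNotions.

Arguments quotJ : clear implicits.

Section Endomorphisms.
Variables (S : pzRingType) (M : lmodType S).

Definition EndRing := {linear M -> M}.

HB.instance Definition _ := gen_eqMixin EndRing.
HB.instance Definition _ := gen_choiceMixin EndRing.

Implicit Types f g h : EndRing.

Lemma EndRing_ext f g : f =1 g -> f = g.
Proof.
case: f g => [f [[fa] [fs]]] [g [[ga] [gs]]] /= /funext efg.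
subst g; congr GRing.Linear.Pack.
by rewrite (Prop_irrelevance fa ga) (Prop_irrelevance fs gs).
Qed.

Definition EndRing_zero : EndRing := \0.
Definition EndRing_opp f : EndRing := \- f.
Definition EndRing_add f g : EndRing := f \+ g.
Definition EndRing_one : EndRing := idfun.
(* Endomorphisms of a right module act on the left: (f * g) x = f (g x). *)
Definition EndRing_mul f g : EndRing := f \o g.

Lemma EndRing_addA : associative EndRing_add.
Proof. by move=> f g h; apply: EndRing_ext => x /=; rewrite addrA. Qed.
Lemma EndRing_addC : commutative EndRing_add.
Proof. by move=> f g; apply: EndRing_ext => x /=; rewrite addrC. Qed.
Lemma EndRing_add0r : left_id EndRing_zero EndRing_add.
Proof. by move=> f; apply: EndRing_ext => x /=; rewrite add0r. Qed.
Lemma EndRing_addNr : left_inverse EndRing_zero EndRing_opp EndRing_add.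
Proof. by move=> f; apply: EndRing_ext => x /=; rewrite addNr. Qed.

HB.instance Definition _ :=
  GRing.isZmodule.Build EndRing EndRing_addA EndRing_addC EndRing_add0r EndRing_addNr.

Lemma EndRing_mulA : associative EndRing_mul.
Proof. by move=> f g h; apply: EndRing_ext. Qed.
Lemma EndRing_mul1r : left_id EndRing_one EndRing_mul.
Proof. by move=> f; apply: EndRing_ext. Qed.
Lemma EndRing_mulr1 : right_id EndRing_one EndRing_mul.
Proof. by move=> f; apply: EndRing_ext. Qed.
Lemma EndRing_mulDl : left_distributive EndRing_mul +%R.
Proof. by move=> f g h; apply: EndRing_ext. Qed.
Lemma EndRing_mulDr : right_distributive EndRing_mul +%R.
Proof. by move=> f g h; apply: EndRing_ext => x /=; rewrite linearD. Qed.

HB.instance Definition _ := GRing.Zmodule_isPzRing.Build EndRing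
  EndRing_mulA EndRing_mul1r EndRing_mulr1 EndRing_mulDl EndRing_mulDr.

End Endomorphisms.

Section ModuleNotions.
Variable S : pzRingType.
Implicit Types A B E M N X : lmodType S.

Definition injective_module E :=
  forall A B (i : {linear A -> B}) (f : {linear A -> E}), injective i ->
    exists g : {linear B -> E}, forall x, g (i x) = f x.

Definition mod_isomorphic A B := exists f : {linear A -> B}, bijective f.

Definition iso_closed (C : lmodType S -> Prop) :=
  forall A B, mod_isomorphic A B -> C A -> C B.

Definition is_precover (C : lmodType S -> Prop) X M (p : {linear X -> M}) :=
  C X /\
  forall X' (q : {linear X' -> M}), C X' ->
    exists h : {linear X' -> X}, forall x, p (h x) = q x.

Definition is_cover (C : lmodType S -> Prop) X M (p : {linear X -> M}) :=
  is_precover C p /\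
  forall h : {linear X -> X}, (forall x, p (h x) = p x) -> bijective h.

Definition is_epi X M (p : {linear X -> M}) := forall y, exists x, p x = y.

Definition automorphism_coinvariant (C : lmodType S -> Prop) M :=
  exists X, exists2 p : {linear X -> M}, is_cover C p &
    forall g : {linear X -> X}, bijective g ->
      exists f : {linear M -> M}, forall x, f (p x) = p (g x).

Definition internal_direct_sum (I : finType) A (B : I -> {pred A}) :=
  [/\ forall i, GRing.submod_closed (B i),
      forall a, exists2 b : I -> A, (forall i, b i \in B i) & a = \sum_i b i
    & forall b : I -> A, (forall i, b i \in B i) -> \sum_i b i = 0 ->
        forall i, b i = 0].

Definition submod_isomorphic_to A (M' : {pred A}) M :=
  exists2 f : {linear M -> A}, injective f &
    forall a, a \in M' <-> exists x, f x = a.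

(* Indexing by bool encodes A = M' (+) N, and by option I the decomposition
   A = M' (+) (\bigoplus_i B i), with M' at index None. *)
Definition finite_exchange M :=
  forall (I : finType) A (M' N : {pred A}) (A_ : I -> {pred A}),
    submod_isomorphic_to M' M ->
    internal_direct_sum (fun b : bool => if b then M' else N) ->
    internal_direct_sum A_ ->
    exists B : I -> {pred A},
      [/\ forall i, GRing.submod_closed (B i),
          forall i, {subset B i <= A_ i}
        & internal_direct_sum (fun o => if o is Some i then B i else M')].

End ModuleNotions.

Definition right_self_injective (R : pzRingType) :=
  injective_module ((R^c)^o : rmodType R).

(* Main.v *)
Require Import Defs.
From HB Require Import structures.
From mathcomp Require Import all_boot all_order all_algebra all_classical.

(* Lifting along the precover p and descending along the automorphisms of X,
   which all act on M, turns a decomposition "idempotent + automorphism" of an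
   endomorphism of X into one of an endomorphism of M.  So End(M) is a clean
   ring once End(X) is, and End(X) is clean once End(X)/J is, since idempotents
   and units lift modulo J.

   A regular right self-injective ring T is clean: by Zorn's lemma, choose a
   maximal summand h T, invariant under left multiplication by a, on which a is
   idempotent + automorphism.  If h <> 1, then a induces some g on (1 - h) T,
   and g is clean on a nonzero summand: on part of its kernel if it is not
   injective, on all of (1 - h) T if it is bijective, and on the hull of an
   infinite sum on which it is a shift otherwise.  Adding that summand to h T
   makes a block triangular, which contradicts maximality.

   Clean rings are exchange rings.  If f_i is the projection of A onto A_i
   compressed to M, the exchange property of End(M) gives orthogonal idempotents
   e_i = g_i f_i of sum 1 with e_i g_i = g_i.  Then theta, the sum of the maps
   A -> A_i -> M followed by g_i, is a retraction of A onto M, and its kernel is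
   the direct sum of its intersections with the A_i. *)

Set Implicit Arguments.
Unset Strict Implicit.
Unset Printing Implicit Defensive.

Import GRing.Theory.

Local Open Scope ring_scope.

(** * Maximal right ideals and units modulo the Jacobson radical *)

Section RightIdeals.
Variable R : pzRingType.
Implicit Types (I K L N : {pred R}) (a b x y : R).

(** Zorn's lemma in a form that serves twice: [N = {1}] gives maximal right ideals, and taking for
    [N] the nonzero elements of a right ideal gives relative complements. *)
Lemma exists_maximal_avoiding I N :
    right_ideal I -> (forall x, x \in I -> x \notin N) ->
  exists K, [/\ right_ideal K, {subset I <= K}, forall x, x \in K -> x \notin N
    & forall L, right_ideal L -> {subset K <= L} ->
        (forall x, x \in L -> x \notin N) -> {subset L <= K}].
Proof.
move=> iI IN.
pose good K := [/\ right_ideal K, {subset I <= K}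
                 & forall x, x \in K -> x \notin N].
pose le (s t : {K | good K}) := `[< {subset sval s <= sval t} >].
have goodI : good I by split.
have [t||A tA|[K [iK IK KN]] Kmax] := ZL_preorder (exist _ I goodI) (R := le).
- by apply/asboolP.
- by move=> r s t /asboolP rs /asboolP st; apply/asboolP => x /rs/st.
(* The union is joined with [I], so that the empty chain has an upper bound too. *)
- pose U : {pred R} := fun x => `[< x \in I \/ exists2 t, A t & x \in sval t >].
  have goodU : good U.
    split.
    + apply/right_idealP; split; first by apply/asboolP; left; apply: right_ideal0.
      move=> a u v /asboolP uU /asboolP vU; apply/asboolP.
      case: uU vU => [uI|[s As us]] [vI|[t At vt]].
      * by left; apply: right_idealMD.
      * have [it It _] := svalP t.
        by right; exists t => //; apply: right_idealMD => //; apply: It.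
      * have [js Is _] := svalP s.
        by right; exists s => //; apply: right_idealMD => //; apply: Is.
      * have [it _ _] := svalP t; have [js _ _] := svalP s.
        right; have [/asboolP st|/asboolP ts] := tA _ _ As At.
          by exists t => //; apply: right_idealMD => //; apply: st.
        by exists s => //; apply: right_idealMD => //; apply: ts.
    + by move=> x xI; apply/asboolP; left.
    + by move=> x /asboolP[/IN//|[t _ xt]]; have [_ _] := svalP t; apply.
  exists (exist _ U goodU) => s As; apply/asboolP => x xs.
  by apply/asboolP; right; exists s.
exists K; split=> // L iL KL LN.
have gL : good L by split=> // x /IK/KL.
by have /asboolP := Kmax (exist _ L gL) (asboolT KL).
Qed.

Lemma principal_right_ideal x : right_ideal [pred y | `[< exists z, y = x * z >]].
Proof.
apply/right_idealP; split; first by apply/asboolP; exists 0; rewrite mulr0.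
move=> a u v /asboolP[z ->] /asboolP[t ->]; apply/asboolP.
by exists (z * a + t); rewrite mulrDr mulrA.
Qed.

(** If [x R] were proper, a maximal right ideal would contain both [x] and [1 - x], hence [1]. *)
Lemma jacobson_right_inverse x : 1 - x \in @jacobson R -> exists y, x * y = 1.
Proof.
move=> /jacobsonP xJ; have [//|nx] := pselect (exists y, x * y = 1); exfalso.
have [|K [iK xK K1 Kmax]] :=
    exists_maximal_avoiding (N := pred1 1) (principal_right_ideal x).
  by move=> y /asboolP[z ->]; apply/eqP => xz; apply: nx; exists z.
have n1K : 1 \notin K by apply/negP => /K1; rewrite inE eqxx.
have mK : maximal_right_ideal K.
  split=> // L iL KL n1L; apply: Kmax => // y yL.
  by apply: contraNN n1L => /eqP <-.
case/negP: n1K; rewrite -(subrK x 1); apply: right_idealD => //; first exact: xJ.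
by apply: xK; apply/asboolP; exists 1; rewrite mulr1.
Qed.

(** A right inverse [y] of [x] is again congruent to [1], so it has a right inverse as well, which
    must be [x]. *)
Lemma jacobson_unit x :
  1 - x \in @jacobson R -> exists2 y, x * y = 1 & y * x = 1.
Proof.
move=> xJ; have [y xy] := jacobson_right_inverse xJ; exists y => //.
have [|z yz] := @jacobson_right_inverse y.
  suff -> : 1 - y = - ((1 - x) * y) by rewrite rpredN jacobson_mulr.
  by rewrite mulrBl mul1r xy opprB.
by have -> : x = z; rewrite // -[x]mulr1 -yz mulrA xy mul1r.
Qed.

End RightIdeals.

(** * Submodules as modules and Baer's criterion *)

Section Submodules.
Variables (S : pzRingType) (V : lmodType S) (W : submodClosed V).

Definition submodule := {x : V | x \in W}.
HB.instance Definition _ := SubChoice.on submodule.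
HB.instance Definition _ := [SubChoice_isSubLmodule of submodule by <:].

End Submodules.

Section InjectiveModules.
Variables (S : pzRingType) (E V : lmodType S).

(** Accepting a plain function that is linear only on [W] allows maps defined by choice. *)
Lemma injective_extension (W : {pred V}) (f : V -> E) :
    injective_module E -> GRing.submod_closed W ->
    (forall a x y, x \in W -> y \in W -> f (a *: x + y) = a *: f x + f y) ->
  exists g : {linear V -> E}, forall x, x \in W -> g x = f x.
Proof.
move=> injE clW fL.
pose mW := GRing.isSubmodClosed.Build S V W clW.
pose W' : submodClosed V := HB.pack W mW.
pose A := submodule W'.
pose fA (x : A) := f (val x).
have fA_lin : linear fA by move=> a x y; rewrite /fA linearP fL ?(valP x) ?(valP y).
pose mf := GRing.isLinear.Build S A E *:%R fA fA_lin.
pose fA' : {linear A -> E} := HB.pack fA mf.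
have [g gE] := injE _ _ (val : {linear A -> V}) fA' val_inj.
by exists g => x xW; exact: (gE (exist _ x xW)).
Qed.

End InjectiveModules.

(** An extension to all of [T] is a module endomorphism of [T], hence left multiplication by its
    value at [1]. *)
Lemma baer (T : pzRingType) (W : {pred T}) (f : T -> T) :
    right_self_injective T -> right_ideal W ->
    (forall a x y, x \in W -> y \in W -> f (x * a + y) = f x * a + f y) ->
  exists t, forall x, x \in W -> t * x = f x.
Proof.
move=> injT iW fL.
have [g gE] := injective_extension (E := (T^c)^o) (V := (T^c)^o) injT iW fL.
exists (g 1) => x xW; rewrite -gE //.
have {2}-> : x = (x : T^c) *: (1 : (T^c)^o) by rewrite /GRing.scale /= /GRing.mul /= mul1r.
by rewrite linearZ.
Qed.

(** * Regular right self-injective rings are clean *)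

Section RegularSelfInjective.
Variable T : pzRingType.
Hypothesis regT : von_neumann_regular T.
Hypothesis injT : right_self_injective T.
Implicit Types (W V : {pred T}) (a b c d e g h k u v w x y z : T).

(** [h T] is an injective hull of [W]: [h] extends the projection of [W + V] onto [W], where [V] is
    a maximal right ideal meeting [W] trivially. The other claims hold because, by regularity, no
    nonzero [d] kills [W + V] from the left. *)
Lemma injective_hull_idempotent W : right_ideal W ->
  exists h, [/\ h * h = h, forall w, w \in W -> h * w = w &
    forall d d', (forall w, w \in W -> d * w = d' * w) -> d * h = d' * h].
Proof.
move=> iW.
pose N := [pred x | (x \in W) && (x != 0)].
have [||V [iV _ VN Vmax]] := @exists_maximal_avoiding T (pred1 0) N.
- apply/right_idealP; split=> [|a u v]; rewrite !inE ?eqxx //.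
  by move=> /eqP-> /eqP->; rewrite mul0r addr0.
- by move=> x /eqP->; rewrite !inE eqxx andbF.
have VW x : x \in V -> x \in W -> x = 0.
  by move=> xV xW; apply/eqP; move: (VN x xV); rewrite !inE xW negbK.
(* [q] is idempotent with [d q = d]. The right ideal [L = V + q T] still meets [W] trivially, as [d]
   kills [V] and [W]; maximality puts [q] in [V], so [d = d q = 0]. *)
have killed d : (forall w, w \in W -> d * w = 0) ->
    (forall v, v \in V -> d * v = 0) -> d = 0.
  move=> dW dV; have [z dz] := regT d; pose q := z * d.
  have qq : q * q = q by rewrite /q mulrA -(mulrA z d) -(mulrA z) -dz.
  have dq : d * q = d by rewrite /q mulrA -dz.
  pose L := [pred x | `[< exists r, x - q * r \in V >]].
  have /(_ q) : {subset L <= V}.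
    apply: Vmax => [||x /asboolP[r xV]].
    - apply/right_idealP; split.
        by apply/asboolP; exists 0; rewrite mulr0 subr0 right_ideal0.
      move=> a x y /asboolP[r xV] /asboolP[s yV]; apply/asboolP.
      exists (r * a + s); rewrite mulrDr mulrA opprD addrACA -mulrBl.
      exact: right_idealMD.
    - by move=> x xV; apply/asboolP; exists 0; rewrite mulr0 subr0.
    - rewrite !inE; apply/negP => /andP[xW]; apply/negP; rewrite negbK.
      have qr0 : q * r = 0.
        have: d * (x - q * r) = 0 by exact: dV.
        rewrite mulrBr dW // sub0r mulrA dq => /eqP; rewrite oppr_eq0 => /eqP dr.
        by rewrite /q -mulrA dr mulr0.
      by move: xV; rewrite qr0 subr0 => /VW->.
  have qL : q \in L by apply/asboolP; exists 1; rewrite mulr1 subrr right_ideal0.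
  by move=> /(_ qL) /dV; rewrite dq.
pose U := [pred x | `[< exists w, w \in W /\ x - w \in V >]].
(* The projection of [U = W + V] onto [W]; the default [0] is taken only outside [U]. *)
pose f x := xget 0 [set w | w \in W /\ x - w \in V]%classic.
have fP x w : w \in W -> x - w \in V -> f x = w.
  move=> wW xwV; rewrite /f; case: xgetP => [y _ [yW xyV]|/(_ w)[]] //.
  apply/eqP; rewrite -subr_eq0; apply/eqP/VW; last exact: right_idealB.
  have -> : y - w = (x - w) - (x - y) by rewrite opprB [RHS]addrC addrA subrK.
  exact: right_idealB.
have [||h hf] := @baer T U f injT.
- apply/right_idealP; split.
    by apply/asboolP; exists 0; rewrite subr0; split; apply: right_ideal0.
  move=> a x y /asboolP[w [wW xV]] /asboolP[w' [w'W yV]]; apply/asboolP.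
  exists (w * a + w'); rewrite opprD addrACA -mulrBl.
  by split; apply: right_idealMD.
- move=> a x y /asboolP[w [wW xV]] /asboolP[w' [w'W yV]].
  rewrite (fP x w) // (fP y w') //; apply: fP; first exact: right_idealMD.
  by rewrite opprD addrACA -mulrBl; apply: right_idealMD.
have hW w : w \in W -> h * w = w.
  move=> wW; rewrite hf; last first.
    by apply/asboolP; exists w; rewrite subrr right_ideal0.
  by apply: fP; rewrite ?subrr ?right_ideal0.
have hV v : v \in V -> h * v = 0.
  move=> vV; have v0V : v - 0 \in V by rewrite subr0.
  have W0 := right_ideal0 iW; rewrite hf; last by apply/asboolP; exists 0.
  exact: fP.
exists h; split=> //.
- apply/eqP; rewrite -subr_eq0 -{3}[h]mul1r -mulrBl; apply/eqP/killed.
    by move=> w wW; rewrite -mulrA hW // mulrBl hW // mul1r subrr.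
  by move=> v vV; rewrite -mulrA hV // mulr0.
- move=> d d' dd'; apply/eqP; rewrite -subr_eq0 -mulrBl; apply/eqP/killed.
    by move=> w wW; rewrite -mulrA hW // mulrBl dd' // subrr.
  by move=> v vV; rewrite -mulrA hV // mulr0.
Qed.

(* The restriction of [a] to the [a]-invariant summand [h T] is the sum of the
   idempotent [e] and an automorphism of [h T] with inverse [v]. *)
Definition clean_on a h e v : Prop :=
  [/\ h * h = h, h * a * h = a * h, [/\ h * e = e, e * h = e & e * e = e],
      h * v = v /\ v * h = v & (a * h - e) * v = h /\ v * (a * h - e) = h].

(** An identity [d * h = d' * h] can be tested on [W], so [e] and [v] need to behave well only
    there. *)
Lemma clean_on_hull a e v h W :
    h * h = h -> (forall w, w \in W -> h * w = w) ->
    (forall d d', (forall w, w \in W -> d * w = d' * w) -> d * h = d' * h) ->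
    (forall w, w \in W -> [/\ a * w \in W, e * w \in W & v * w \in W]) ->
    (forall w, w \in W -> [/\ e * (e * w) = e * w, (a - e) * (v * w) = w
                         & v * ((a - e) * w) = w]) ->
  clean_on a h (e * h) (v * h).
Proof.
move=> hh hW hE sW eqW.
have stable c : (forall w, w \in W -> c * w \in W) -> h * c * h = c * h.
  by move=> cW; apply: hE => w /cW cwW; rewrite -mulrA hW.
have ha : h * a * h = a * h by apply: stable => w /sW[].
have he : h * (e * h) = e * h by rewrite mulrA; apply: stable => w /sW[].
have hv : h * (v * h) = v * h by rewrite mulrA; apply: stable => w /sW[].
have ee : e * h * (e * h) = e * h.
  by rewrite -mulrA he mulrA; apply: hE => w /eqW[]; rewrite -mulrA.
have uv : (a * h - e * h) * (v * h) = h.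
  rewrite -mulrBl -mulrA hv mulrA -[RHS]mul1r; apply: hE => w /eqW[_ + _].
  by rewrite mul1r mulrA.
have vu : v * h * (a * h - e * h) = h.
  rewrite -mulrA mulrBr he mulrA ha -mulrBl mulrA -[RHS]mul1r.
  by apply: hE => w /eqW[_ _]; rewrite mul1r mulrA.
by split=> //; split; rewrite // -mulrA hh.
Qed.

(** Upper bounds of chains: the [e] and [v] of a chain agree on overlaps, so Baer's criterion glues
    them on the union [W] of the summands, and [clean_on_hull] passes to the hull of [W], again a
    summand. *)
Lemma clean_on_union a (A : set (T * T * T)) :
    (forall h e v, A (h, e, v) -> clean_on a h e v) ->
    (forall h e v h' e' v', A (h, e, v) -> A (h', e', v') ->
       [/\ h' * h = h, e' * h = e & v' * h = v] \/
       [/\ h * h' = h', e * h' = e' & v * h' = v']) ->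
  exists h e v, clean_on a h e v /\ forall h' e' v', A (h', e', v') ->
    [/\ h * h' = h', e * h' = e' & v * h' = v'].
Proof.
move=> Ac Atot.
pose W := [pred w | `[< w = 0 \/ exists2 t, A t & t.1.1 * w = w >]].
have iW : right_ideal W.
  apply/right_idealP; split; first by apply/asboolP; left.
  move=> b x y /asboolP[->|[[[h e] v] At /= hx]] /asboolP[->|[[[h' e'] v'] At' /= hy]];
    apply/asboolP; rewrite ?mul0r ?addr0 ?add0r; [by left| | |]; right.
  - by exists (h', e', v').
  - by exists (h, e, v) => //=; rewrite mulrA hx.
  - have [[hh _ _]|[hh _ _]] := Atot _ _ _ _ _ _ At At'.
      by exists (h', e', v') => //=; rewrite mulrDr hy mulrA -{1}hx mulrA hh hx.
    by exists (h, e, v) => //=; rewrite mulrDr -{1}hy (mulrA h h') hh hy mulrA hx.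
have WP x h e v : A (h, e, v) -> h * x = x -> x \in W.
  by move=> At hx; apply/asboolP; right; exists (h, e, v).
(* [F] will be the second or third component. [f w] is computed through any triple whose summand
   contains [w]; comparability makes the choice irrelevant. *)
have glue (F : T * T * T -> T) :
    (forall h e v h' e' v', A (h, e, v) -> A (h', e', v') -> h' * h = h ->
       e' * h = e -> v' * h = v -> F (h', e', v') * h = F (h, e, v)) ->
    (forall t, A t -> F t * t.1.1 = F t) ->
    exists c, forall t, A t -> c * t.1.1 = F t.
  move=> Fle Fh.
  pose f w := if w == 0 then 0 else
    F (xget (0, 0, 0) [set t | A t /\ t.1.1 * w = w]%classic) * w.
  have fP t w : A t -> t.1.1 * w = w -> f w = F t * w.
    move=> At tw; rewrite /f; case: eqP => [->|_]; first by rewrite mulr0.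
    case: xgetP => [s _ [As sw]|/(_ t)[]//].
    move: t s At As tw sw => [[h e] v] [[h' e'] v'] At At' /= hw h'w.
    have [[hh ee vv]|[hh ee vv]] := Atot _ _ _ _ _ _ At At'.
      by rewrite -{1}hw mulrA (Fle _ _ _ _ _ _ At At').
    by rewrite -{2}h'w mulrA (Fle _ _ _ _ _ _ At' At).
  have [|c cf] := @baer T W f injT iW.
    have f0 : f 0 = 0 by rewrite /f eqxx.
    move=> b x y /asboolP[->|[[[h e] v] At hx]] /asboolP[->|[[[h' e'] v'] At' hy]].
    - by rewrite f0 !mul0r !addr0 f0.
    - by rewrite f0 !mul0r !add0r.
    - rewrite f0 !addr0 (fP _ _ At hx) (fP _ _ At) ?mulrA //=.
      by rewrite [h * x]hx.
    - have [[hh _ _]|[hh _ _]] := Atot _ _ _ _ _ _ At At'; rewrite /= in hx hy.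
        have hx' : h' * x = x by rewrite -hx mulrA hh.
        rewrite (fP _ _ At' hx') (fP _ _ At' hy) (fP _ _ At') /= ?mulrDr ?mulrA //.
        by rewrite hx' hy.
      have hy' : h * y = y by rewrite -hy mulrA hh.
      rewrite (fP _ _ At hx) (fP _ _ At hy') (fP _ _ At) /= ?mulrDr ?mulrA //.
      by rewrite hx hy'.
  exists c => -[[h e] v] At /=; have [hh _ _ _ _] := Ac _ _ _ At.
  rewrite cf; last exact: (WP _ _ _ _ At).
  by rewrite (fP _ _ At) // Fh.
have [h [hh hW hE]] := injective_hull_idempotent iW.
have [|[[h' e'] v'] At|eps epsE] := glue (fun t => t.1.2).
- by move=> *.
- by have [_ _ [_ ? _] _ _] := Ac _ _ _ At.
have [|[[h' e'] v'] At|nu nuE] := glue (fun t => t.2).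
- by move=> *.
- by have [_ _ _ [_ ?] _] := Ac _ _ _ At.
exists h, (eps * h), (nu * h).
have WE w : w \in W -> w = 0 \/ exists h' e' v', [/\ A (h', e', v'),
    clean_on a h' e' v', h' * w = w, eps * w = e' * w & nu * w = v' * w].
  move=> /asboolP[->|[[[h' e'] v'] At /= hw]]; [by left|right].
  exists h', e', v'; split=> //; first exact: Ac.
    by rewrite -{1}hw mulrA (epsE _ At).
  by rewrite -{1}hw mulrA (nuE _ At).
have hA h' e' v' : A (h', e', v') -> h * h' = h'.
  by move=> At; have [hh' _ _ _ _] := Ac _ _ _ At; apply/hW/(WP _ _ _ _ At).
split; last first.
  move=> h' e' v' At; split; first exact: hA At.
    by rewrite -mulrA (hA _ _ _ At) (epsE _ At).
  by rewrite -mulrA (hA _ _ _ At) (nuE _ At).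
have aW w : w \in W -> a * w \in W.
  move=> /WE[->|[h' [e' [v' [At [_ ha _ _ _] hw _ _]]]]].
    by rewrite mulr0 right_ideal0.
  by apply: (WP _ _ _ _ At); rewrite -hw !mulrA ha.
have eW w : w \in W -> eps * w \in W.
  move=> /WE[->|[h' [e' [v' [At [_ _ [he _ _] _ _] hw ew _]]]]].
    by rewrite mulr0 right_ideal0.
  by apply: (WP _ _ _ _ At); rewrite ew !mulrA he.
have vW w : w \in W -> nu * w \in W.
  move=> /WE[->|[h' [e' [v' [At [_ _ _ [hv _] _] hw _ vw]]]]].
    by rewrite mulr0 right_ideal0.
  by apply: (WP _ _ _ _ At); rewrite vw !mulrA hv.
have eval t w : A t -> t.1.1 * w = w -> eps * w = t.1.2 * w /\ nu * w = t.2 * w.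
  by move=> At tw; rewrite -{1 3}tw !mulrA (epsE _ At) (nuE _ At).
apply: clean_on_hull hE _ _ => // w wW; first by split; [apply: aW|apply: eW|apply: vW].
have [->|[h' [e' [v' [At [_ ha [he _ ee] [hv _] [uv vu]] hw ew vw]]]]] := WE w wW.
  by rewrite !mulr0.
have hew : h' * (e' * w) = e' * w by rewrite mulrA he.
have hvw : h' * (v' * w) = v' * w by rewrite mulrA hv.
have aew : (a - eps) * w = (a * h' - e') * w by rewrite !mulrBl ew -mulrA hw.
have huw : h' * ((a - eps) * w) = (a - eps) * w.
  by rewrite aew mulrA mulrBr mulrA ha he.
split.
- by rewrite ew; have [-> _] := eval _ _ At hew; rewrite /= mulrA ee.
- have [/= ev _] := eval _ _ At hvw.
  by rewrite vw mulrBl ev -{1}hvw mulrA -mulrBl mulrA uv.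
- by have [_ /= ->] := eval _ _ At huw; rewrite aew mulrA vu.
Qed.

(** On [h T + h' T], [a] is block upper triangular with corner [B = h a h']. The inverse of the
    triangular matrix with diagonal [U], [D] has corner [- v B v'], which is [- v a v']. *)
Lemma clean_on_add a h e v h' e' v' (k := 1 - h) :
    clean_on a h e v -> clean_on (k * a * k) h' e' v' ->
    k * h' = h' -> h' * k = h' ->
  clean_on a (h + h') (e + e') (v + v' - v * a * v').
Proof.
move=> [hh ha [he eh ee] [hv vh] [uv vu]].
move=> [h'h' h'g [h'e' e'h' e'e'] [h'v' v'h'] [uv' vu']] kh' h'k.
have hh' : h * h' = 0 by rewrite -kh' mulrA mulrBr mulr1 hh subrr mul0r.
have h'h : h' * h = 0 by rewrite -h'k -mulrA mulrBl mul1r hh subrr mulr0.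
have hx x : h' * x = x -> h * x = 0 by move=> <-; rewrite mulrA hh' mul0r.
have h'x x : h * x = x -> h' * x = 0 by move=> <-; rewrite mulrA h'h mul0r.
have xh x y : x * h' = x -> h * y = y -> x * y = 0.
  by move=> <- <-; rewrite mulrA -(mulrA x) h'h mulr0 mul0r.
have xh' x y : x * h = x -> h' * y = y -> x * y = 0.
  by move=> <- <-; rewrite mulrA -(mulrA x) hh' mulr0 mul0r.
have ah' : a * h' = h * a * h' + k * a * k * h'.
  by rewrite -[k * a * k * h']mulrA kh' -!mulrDl /k addrC subrK mul1r.
set g := k * a * k in h'g uv' vu' ah'.
pose B := h * a * h'; pose U := a * h - e; pose D := g * h' - e'.
have hU : h * U = U by rewrite mulrBr mulrA ha he.
have Uh : U * h = U by rewrite mulrBl -mulrA hh eh.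
have h'D : h' * D = D by rewrite mulrBr mulrA h'g h'e'.
have Dh' : D * h' = D by rewrite mulrBl -mulrA h'h' e'h'.
have hB : h * B = B by rewrite !mulrA hh.
have Bh' : B * h' = B by rewrite -mulrA h'h'.
have u'E : a * (h + h') - (e + e') = U + (B + D).
  by rewrite mulrDr ah' opprD addrACA -[B + _ - e']addrA.
pose z := v * a * v'.
have hz : h * z = z by rewrite !mulrA hv.
have zh' : z * h' = z by rewrite -mulrA v'h'.
rewrite -/z; split.
- by rewrite mulrDl !mulrDr hh hh' h'h h'h' addr0 add0r.
- have hah : h * (a * h) = a * h by rewrite mulrA.
  rewrite -mulrA mulrDr mulrDr !mulrDl hah (h'x _ hah) addr0 ah' !mulrDr.
  have h'gh' : h' * (g * h') = g * h' by rewrite mulrA.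
  by rewrite hB (h'x _ hB) (hx _ h'gh') h'gh' addr0 add0r.
- split.
  + by rewrite mulrDl !mulrDr he h'e' (hx _ h'e') (h'x _ he) addr0 add0r.
  + by rewrite mulrDr !mulrDl eh e'h' (xh e' h) // (xh' e h') // addr0 add0r.
  + by rewrite mulrDr !mulrDl ee e'e' (xh e' e) // (xh' e e') // addr0 add0r.
- split.
  + rewrite mulrDl !mulrBr !mulrDr hv h'v' (hx _ h'v') (h'x _ hv) hz (h'x _ hz).
    by rewrite addr0 add0r subr0 addrAC.
  + rewrite mulrDr !mulrBl !mulrDl vh v'h' zh' (xh' v h') // (xh v' h) //.
    by rewrite (xh z h) // addr0 add0r subr0 addrA.
- have Uz : U * z = h * a * v' by rewrite !mulrA uv.
  have Bv' : B * v' = h * a * v' by rewrite /B -(mulrA _ h') h'v'.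
  have vB : v * B = v * a * h' by rewrite !mulrA vh.
  have zD : z * D = v * a * h' by rewrite /z -(mulrA _ v') vu'.
  have [[Uv vU] [Dv' v'D]] : (U * v = h /\ v * U = h) /\ (D * v' = h' /\ v' * D = h').
    by [].
  rewrite u'E; clearbody U B D z; split.
  + rewrite mulrBr !mulrDr !mulrDl Uv Dv' Uz Bv' (xh' U v') // (xh B v) //.
    rewrite (xh D v) // (xh B z) // (xh D z) // !addr0 add0r.
    by rewrite [h * a * v' + h']addrC addrA addrK.
  + rewrite !mulrDr !mulrBl !mulrDl vU v'D vB zD (xh' v D) // (xh v' U) //.
    rewrite (xh v' B) // (xh z U) // (xh z B) // !addr0 !add0r !subr0.
    by rewrite [v * a * h' + _]addrCA subrr addr0.
Qed.

(* If [g] is injective on [k T] but not surjective there, its left inverse [z]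
   makes it a shift on the sum of the [g ^ n (k - g z) T].  There
   [c = k - g z + g^2 z^2 - ...] is the projection onto the even powers, and
   [(1 + g - z) c] is an idempotent whose difference with [g] is invertible. *)
Lemma clean_on_piece k g : k * k = k -> k != 0 -> k * g = g -> g * k = g ->
  exists h e v, [/\ h != 0, k * h = h, h * k = h & clean_on g h e v].
Proof.
move=> kk k0 kg gk.
(* If [g] kills a nonzero [y] in [k T], regularity gives [y T = h T]; there [g] is zero, the sum of
   the idempotent [h] and the automorphism [- h]. *)
have [[y [ky y0 gy]]|gI] := pselect (exists y, [/\ k * y = y, y <> 0 & g * y = 0]).
  have [x yx] := regT y; pose h := y * x * k.
  have hy : h * y = y by rewrite /h -mulrA ky -yx.
  have kh : k * h = h by rewrite /h !mulrA ky.
  have hk : h * k = h by rewrite /h -mulrA kk.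
  have hh : h * h = h by rewrite {2}/h !mulrA hy.
  have gh : g * h = 0 by rewrite /h !mulrA gy !mul0r.
  exists h, h, (- h); split=> //.
    by apply/eqP => h0; apply: y0; rewrite -hy h0 mul0r.
  clearbody h; split; rewrite ?gh -?mulrA ?gh ?sub0r ?mulr0 ?mulrN ?mulNr ?opprK ?hh //;
    by split; rewrite ?hh.
have {}gI y : k * y = y -> g * y = 0 -> y = 0.
  by move=> ky gy; have [//|y0] := pselect (y = 0); case: gI; exists y.
(* A regular inverse of [g], compressed by [k], is a left inverse of [g] on [k T] by injectivity;
   [Y] measures the failure of surjectivity. *)
have [z0 gz0] := regT g; pose z := k * z0 * k.
have kz : k * z = z by rewrite !mulrA kk.
have zk : z * k = z by rewrite -mulrA kk.
have zg : z * g = k.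
  apply/eqP; rewrite -subr_eq0; apply/eqP/gI.
    by rewrite mulrBr mulrA kz kk.
  by rewrite mulrBr gk /z -(mulrA _ k g) kg !mulrA gk -gz0 subrr.
clearbody z; pose Y := k - g * z.
have [Y0|Yn0] := eqVneq Y 0.
  have gz : g * z = k by apply/esym/eqP; rewrite -subr_eq0 -/Y Y0.
  exists k, 0, z; split=> //.
  split; rewrite ?kk -?mulrA ?gk ?kg ?mulr0 ?mul0r ?subr0 //;
    by split; rewrite ?mulr0 ?mul0r ?kk.
have kY : k * Y = Y by rewrite mulrBr kk mulrA kg.
have zY : z * Y = 0 by rewrite mulrBr zk mulrA zg kz subrr.
have Yg : Y * g = 0 by rewrite mulrBl kg -mulrA zg gk subrr.
have YE : Y = k - g * z by [].
(* [P n] is the sum of [(-1)^j g^j z^j] for [j < n], with [k] as the term [j = 0]. On elements of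
   [k T] killed by [z ^+ n] it is constant from [n] on. *)
clearbody Y; pose P := fix P n := if n is n'.+1 then k - g * P n' * z else 0.
have Pstab n m w : z ^+ n * w = 0 -> (n <= m)%N -> P m * w = P n * w.
  elim: n m w => [|n IH] [|m] w //=; first by rewrite expr0 mul1r => ->; rewrite !mulr0.
  rewrite exprSr -mulrA ltnS => zw /(IH _ _ zw) Pw.
  by rewrite !mulrBl -!mulrA Pw.
pose W := [pred w | `[< k * w = w /\ exists n, z ^+ n * w = 0 >]].
have iW : right_ideal W.
  apply/right_idealP; split.
    by apply/asboolP; rewrite mulr0; split=> //; exists 0; rewrite mulr0.
  move=> b x y /asboolP[kx [n zx]] /asboolP[ky [m zy]]; apply/asboolP.
  split; first by rewrite mulrDr mulrA kx ky.
  exists (n + m)%N; rewrite mulrDr {1}addnC !exprD -!mulrA zy mulr0 addr0.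
  by rewrite (mulrA _ x) zx mul0r mulr0.
(* Induction on the power of [z] that kills [w]. *)
have W_ind (Q : T -> Prop) : Q 0 ->
    (forall w, w \in W -> z * w \in W -> Q (z * w) -> Q w) ->
    forall w, w \in W -> Q w.
  move=> Q0 QS w /asboolP[kw [n zw]].
  elim: n w kw zw => [|n IH] w kw; first by rewrite expr0 mul1r => ->.
  move=> zw; apply: QS; last apply: IH.
  - by apply/asboolP; split=> //; exists n.+1.
  - by apply/asboolP; rewrite mulrA kz; split=> //; exists n; rewrite mulrA -exprSr.
  - by rewrite mulrA kz.
  - by rewrite mulrA -exprSr.
pose f w := P (xget 0%N [set n | z ^+ n * w = 0]%classic) * w.
have fP n w : z ^+ n * w = 0 -> f w = P n * w.
  move=> zw; rewrite /f; case: xgetP => [m _ /= zw'|/(_ n)//].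
  by have [/(Pstab _ _ _ zw)|/ltnW/(Pstab _ _ _ zw')] := leqP n m.
have [|c cf] := @baer T W f injT iW.
  move=> b x y /asboolP[kx [n zx]] /asboolP[ky [m zy]].
  have zx' : z ^+ (n + m) * x = 0 by rewrite addnC exprD -mulrA zx mulr0.
  have zy' : z ^+ (n + m) * y = 0 by rewrite exprD -mulrA zy mulr0.
  rewrite (fP _ _ zx') (fP _ _ zy') (fP (n + m)%N) ?mulrDr ?mulrA //.
  by rewrite zx' zy' mul0r addr0.
have zW : forall w, w \in W -> z * w \in W.
  by apply: W_ind => //; rewrite mulr0 right_ideal0.
have WE w : w \in W -> k * w = w by move=> /asboolP[].
have gW w : w \in W -> g * w \in W.
  move=> /asboolP[kw [n zw]]; apply/asboolP; rewrite mulrA kg; split=> //.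
  by exists n.+1; rewrite exprSr mulrA -(mulrA _ z g) zg -mulrA kw.
(* The recursion of [P] passes to the limit [c]; the facts about [c] below rest on it. *)
have cE w : w \in W -> c * w = w - g * (c * (z * w)).
  move=> wW; have /asboolP[kw [n zw]] := wW.
  have zw' : z ^+ n.+1 * w = 0 by rewrite exprS -mulrA zw mulr0.
  rewrite cf // cf ?zW // (fP _ _ zw') (fP n) /= ?mulrA; last first.
    by rewrite -exprSr.
  by rewrite mulrBl kw.
have cW : forall w, w \in W -> c * w \in W.
  apply: W_ind => [|w wW _ czW]; first by rewrite mulr0 right_ideal0.
  by rewrite cE //; apply: right_idealB => //; apply: gW.
have cg w : w \in W -> c * (g * w) = g * w - g * (c * w).
  by move=> wW; rewrite cE ?gW // (mulrA z) zg WE.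
have cc : forall w, w \in W -> c * (c * w) = c * w.
  apply: W_ind => [|w wW zwW cczw]; first by rewrite !mulr0.
  by rewrite {1}(cE w wW) mulrBr cg ?cW // cczw subrr subr0.
have zc w : w \in W -> z * (c * w) = z * w - c * (z * w).
  by move=> wW; rewrite cE // mulrBr (mulrA z g) zg WE // cW ?zW.
have cz w : w \in W -> c * (z * w) = z * w - z * (c * w).
  by move=> wW; rewrite zc // opprB addrC subrK.
have YW : Y \in W by apply/asboolP; split=> //; exists 1%N; rewrite expr1.
have cY : c * Y = Y by rewrite cE // zY !mulr0 subr0.
have YwW w : Y * w \in W by apply: right_idealM.
have Yc w : w \in W -> Y * (c * w) = Y * w.
  by move=> wW; rewrite cE // mulrBr mulrA Yg mul0r subr0.
have gz w : w \in W -> g * (z * w) = w - Y * w.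
  by move=> wW; rewrite YE mulrBl WE // opprB addrC subrK mulrA.
have [h [hh hW hE]] := injective_hull_idempotent iW.
have kh : k * h = h.
  by rewrite -[RHS]mul1r; apply: hE => w wW; rewrite mul1r WE.
(* Let [p = c w] and [q = w - p] be the even and odd parts of [w]. Then [(g - e) w] has even part
   [g q - p] and odd part [z p]. Solving for [p] and [q], with [Y p] recovered from [Y g = 0], gives
   [v]. *)
pose e := c + g * c - z * c; pose v := z * c - Y + (1 - c) + g * (1 - c).
have ex x : e * x = c * x + g * (c * x) - z * (c * x).
  by rewrite mulrBl mulrDl -!mulrA.
have vx x : v * x = z * (c * x) - Y * x + (x - c * x) + g * (x - c * x).
  by rewrite !mulrDl !mulNr -!mulrA mulrBl !mul1r.
(* [h k] generates the same summand as [h] and is also fixed by right multiplication by [k]. *)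
exists (h * k), (e * (h * k)), (v * (h * k)); split.
- apply/eqP => hk0; case/eqP: Yn0.
  by rewrite -[Y]hW // -[Y]kY mulrA hk0 mul0r.
- by rewrite mulrA kh.
- by rewrite -mulrA kk.
apply: (@clean_on_hull g e v (h * k) W).
- by rewrite mulrA -(mulrA h) kh hh.
- by move=> w wW; rewrite -mulrA WE ?hW.
- by move=> d d' dd'; rewrite !mulrA (hE d d').
- move=> w wW; split; first exact: gW.
    by rewrite ex; apply: right_idealB; rewrite ?right_idealD ?gW ?zW ?cW.
  have c1W : w - c * w \in W by apply: right_idealB; rewrite ?cW.
  rewrite vx; apply: right_idealD => //; last exact: gW.
  by apply: right_idealD => //; apply: right_idealB; rewrite ?zW ?cW.
move=> w wW.
have ux x : (g - e) * x = g * (x - c * x) - c * x + z * (c * x).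
  by rewrite mulrBl ex mulrBr !opprD opprK !addrA; congr (_ + _); rewrite addrAC.
pose p := c * w; pose q := w - p.
have pW : p \in W by apply: cW.
have qW : q \in W by apply: right_idealB.
have cp : c * p = p by apply: cc.
have cq : c * q = 0 by rewrite mulrBr cp subrr.
have cgp : c * (g * p) = 0 by rewrite cg // cp subrr.
have czp : c * (z * p) = 0 by rewrite cz // cp subrr.
have cgq : c * (g * q) = g * q by rewrite cg // cq mulr0 subr0.
have Yp : Y * p = Y * w by apply: Yc.
have Yzp : Y * (z * p) = 0 by rewrite -Yc ?zW // czp mulr0.
have Ygq : Y * (g * q) = 0 by rewrite mulrA Yg mul0r.
have zgq : z * (g * q) = q by rewrite mulrA zg WE.
have gzp : g * (z * p) = p - Y * w by rewrite gz // Yp.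
have cYw : c * (Y * w) = Y * w by rewrite mulrA cY.
have zYw : z * (Y * w) = 0 by rewrite mulrA zY mul0r.
have pq : p + q = w by rewrite addrC subrK.
have vw : v * w = z * p - Y * w + q + g * q by rewrite vx.
have uw : (g - e) * w = g * q - p + z * p by rewrite ux.
clearbody q; split.
- have ew : c * (e * w) = p.
    by rewrite ex -/p mulrBr mulrDr cp cgp czp addr0 subr0.
  by rewrite ex ew ex.
- have cvw : c * (v * w) = g * q - Y * w.
    by rewrite vw !mulrDr mulrN czp cYw cq cgq addr0 sub0r addrC.
  rewrite ux cvw [z * _]mulrBr zgq zYw subr0 vw.
  have -> : z * p - Y * w + q + g * q - (g * q - Y * w) = z * p + q.
    by rewrite opprB addrACA subrr addr0 addrAC subrK.
  by rewrite mulrDr gzp -[RHS]pq opprB addrACA subrr addr0 subrK.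
- have cuw : c * ((g - e) * w) = g * q - p.
    by rewrite uw mulrDr mulrBr cgq cp czp addr0.
  rewrite vx cuw uw [_ + z * p]addrC addrK mulrBr mulrDr mulrBr zgq Yzp Ygq Yp.
  rewrite gzp -[RHS]pq.
  rewrite add0r sub0r opprK [_ + Y * w + _]addrAC subrK addrACA subrr addr0.
  exact: addrC.
Qed.

Lemma regular_self_injective_clean a :
  exists e v, [/\ e * e = e, (a - e) * v = 1 & v * (a - e) = 1].
Proof.
pose Z := {t : T * T * T | clean_on a t.1.1 t.1.2 t.2}.
(* [t] extends [s]: its summand is larger, and its idempotent and inverse restrict to those of
   [s]. *)
pose le (s t : Z) := `[< [/\ (sval t).1.1 * (sval s).1.1 = (sval s).1.1,
  (sval t).1.2 * (sval s).1.1 = (sval s).1.2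
  & (sval t).2 * (sval s).1.1 = (sval s).2] >].
have c0 : clean_on a 0 0 0 by split; rewrite ?mulr0 //; split; rewrite ?mulr0 ?mul0r.
have [|||[[[h e] v] /= hev] hmax] := @ZL_preorder Z (exist _ (0, 0, 0) c0) le.
- move=> [[[h e] v] /= hev]; have [hh _ [_ eh _] [_ vh] _] := hev.
  by apply/asboolP.
- move=> [[[h e] v] c1] [[[h' e'] v'] c2] [[[h'' e''] v''] c3].
  move=> /asboolP[/= hh he hv] /asboolP[/= hh' he' hv']; apply/asboolP => /=.
  by split; rewrite -{1}hh mulrA ?hh' ?he' ?hv'.
- move=> A tA.
  pose B := [set t | exists s, A s /\ sval s = t]%classic.
  have [||h [e [v [hev ub]]]] := @clean_on_union a B.
  + by move=> h e v [s [_ st]]; have := svalP s; rewrite st.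
  + move=> h e v h' e' v' [s [As st]] [s' [As' st']].
    have [/asboolP|/asboolP] := tA _ _ As As'; rewrite st st'; [by left|by right].
  exists (exist _ (h, e, v) hev) => s As; apply/asboolP => /=.
  by apply: ub; exists s; split=> //; case: (sval s) => -[].
have [hh _ [he eh ee] [hv vh] [uv vu]] := hev.
have [h1|k0] := eqVneq (1 - h) 0.
  have {}h1 : h = 1 by apply/esym/eqP; rewrite -subr_eq0 h1.
  by move: uv vu; rewrite h1 mulr1; exists e, v.
pose k := 1 - h.
have kk : k * k = k by rewrite {2}/k mulrBr mulr1 mulrBl hh mul1r subrr subr0.
(* [k a k] is the map that [a] induces on the complement [k T] of the invariant summand [h T]. *)
have [||h' [e' [v' [h'0 kh' h'k hev']]]] := @clean_on_piece k (k * a * k) kk k0.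
- by rewrite !mulrA kk.
- by rewrite -[LHS]mulrA kk.
have hh' : h * h' = 0 by rewrite -kh' mulrA mulrBr mulr1 hh subrr mul0r.
have h'h : h' * h = 0 by rewrite -h'k -mulrA mulrBl mul1r hh subrr mulr0.
have [_ _ [_ e'h' _] [_ v'h'] _] := hev'.
have hev2 := clean_on_add hev hev' kh' h'k.
have le_h : (h + h') * h = h by rewrite mulrDl hh h'h addr0.
have le_e : (e + e') * h = e by rewrite mulrDl eh -e'h' -mulrA h'h mulr0 addr0.
have le_v : (v + v' - v * a * v') * h = v.
  by rewrite mulrBl mulrDl vh -v'h' -!mulrA h'h !mulr0 addr0 subr0.
have /asboolP[/= /eqP] := hmax (exist _ (_, _, _) hev2) (asboolT (And3 le_h le_e le_v)).
by rewrite mulrDr hh hh' addr0 -subr_eq0 opprD addrA subrr sub0r oppr_eq0 (negbTE h'0).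
Qed.

End RegularSelfInjective.

(** * Clean rings and exchange rings *)

Definition clean_ring (R : pzRingType) := forall a : R,
  exists e v, [/\ e * e = e, (a - e) * v = 1 & v * (a - e) = 1].

(** The elementwise criterion of Goodearl and Nicholson, in its left-handed form. *)
Definition exchange_ring (R : pzRingType) := forall a : R,
  exists e x y, [/\ e * e = e, e = x * a & 1 - e = y * (1 - a)].

Section ExchangeRings.
Variable R : pzRingType.
Implicit Types a b c e x y z : R.

(** Conjugating [1 - e] by the unit [u = a - e] gives an idempotent [f] with [a - f = v (a^2 - a)],
    and [a^2 - a] is a left multiple of both [a] and [1 - a]. *)
Lemma clean_exchange : clean_ring R -> exchange_ring R.
Proof.
move=> cleanR a; have [e [v [ee uv vu]]] := cleanR a; set u := a - e in uv vu.
pose f := v * (1 - e) * u.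
have fE : f = a - v * (a * a - a).
  have -> : a * a - a = u * a - (1 - e) * u.
    have -> : u * a = a * a - e * a by rewrite mulrBl.
    have -> : (1 - e) * u = a - e * a.
      by rewrite mulrBl mul1r mulrBr ee opprB addrA subrK.
    by rewrite opprB addrA subrK.
  by rewrite mulrBr !mulrA vu mul1r opprB addrC subrK.
exists f, (1 - v * (a - 1)), (1 - v * a); split.
- have ee' : (1 - e) * (1 - e) = 1 - e by rewrite mulrBr mulr1 mulrBl ee mul1r subrr subr0.
  by rewrite /f -!mulrA (mulrA u) uv mul1r (mulrA (1 - e)) ee'.
- by rewrite fE mulrBl mul1r -mulrA mulrBl mul1r.
- rewrite fE opprB addrCA addrC [RHS]mulrBl mul1r -mulrA.
  by rewrite [a * (1 - a)]mulrBr mulr1 -(mulrN v) opprB.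
Qed.

Hypothesis exR : exchange_ring R.

(** As a left multiple of [a = a c], [e] satisfies [e c = e], which makes [c e] an idempotent of the
    corner [c R c]. *)
Lemma exchange_corner c a : c * c = c -> c * a = a -> a * c = a ->
  exists e x y,
    [/\ e * e = e, c * e = e, e * c = e, e = x * a & c - e = y * (c - a)].
Proof.
move=> cc ca ac; have [e [x [y [ee ex ey]]]] := exR a.
have ec : e * c = e by rewrite ex -mulrA ac.
exists (c * e), (c * x), (c * y); split.
- by rewrite mulrA -(mulrA c e c) ec -mulrA ee.
- by rewrite mulrA cc.
- by rewrite -mulrA ec.
- by rewrite {1}ex mulrA.
- have -> : c - c * e = c * (1 - e) * c by rewrite mulrBr mulr1 mulrBl cc -mulrA ec.
  by rewrite ey -!mulrA mulrBl mul1r ac.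
Qed.

(** The sum [t] of the idempotents need not lie in [c R c]; the last two equations say [t R = c R],
    and give [t = 1] when [c = 1]. In the induction, the corner property splits [c] into [e], served
    by [x k], and [c - e], served by the other [x i]. *)
Lemma exchange_orthogonal_idempotents (I : eqType) (s : seq I) (x y : I -> R) c :
    uniq s -> c * c = c -> c = \sum_(i <- s) y i * x i ->
  exists g : I -> R,
    [/\ {in s &, forall i j,
          (g i * x i) * (g j * x j) = if i == j then g i * x i else 0},
        c * (\sum_(i <- s) g i * x i) = \sum_(i <- s) g i * x i
      & (\sum_(i <- s) g i * x i) * c = c].
Proof.
elim: s y c => [|k s IHs] y c /=.
  by move=> _ _ ->; exists (fun=> 0); rewrite !big_nil mulr0.
case/andP=> ks us cc; rewrite big_cons; set z := \sum_(i <- s) _ => cE.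
have [||e [r [w [ee ce ec er ew]]]] := @exchange_corner c (c * y k * x k * c) cc.
- by rewrite !mulrA cc.
- by rewrite -mulrA cc.
(* An idempotent generating the right ideal [e R] that is moreover a left multiple of [x k]; [d]
   below plays the same role for [c - e] and the remaining [x i]. *)
pose q := e * r * c * y k * x k.
have qc : q * c = e by rewrite -[RHS]ee {2}er /q !mulrA.
have eq : e * q = q by rewrite /q !mulrA ee.
have cq : c * q = q by rewrite -eq mulrA ce.
have ce2 : (c - e) * (c - e) = c - e.
  by rewrite mulrBl !mulrBr cc ce ec ee subrr subr0.
have cce : c * (c - e) = c - e by rewrite mulrBr cc ce.
pose d := (c - e) * (w * c * z).
have dc : d * c = c - e.
  rewrite -[RHS]ce2 [in X in _ = _ * X]ew /d -!mulrA; congr (_ * (_ * _)).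
  by rewrite -[z](addKr (y k * x k)) -cE addrC mulrBl mulrBr cc cc !mulrA.
have dce : d * (c - e) = c - e by rewrite -{1}cce mulrA dc ce2.
have dd : d * d = d by rewrite {2}/d mulrA dce.
have cd : c * d = d by rewrite /d mulrA cce.
have [|g [gg dt td]] := IHs (fun i => (c - e) * (w * c) * y i) d us dd.
  by rewrite /d !mulrA mulr_sumr; apply: eq_bigr => i _; rewrite !mulrA.
set t := \sum_(i <- s) _ in dt td.
have ct : c * t = t by rewrite -dt mulrA cd.
have et : e * t = 0 by rewrite -dt /d mulrA mulrA mulrBr ec ee subrr !mul0r.
have tce : t * (c - e) = c - e by rewrite -dc mulrA td.
have qt : q * t = 0 by rewrite -ct mulrA qc.
(* [q t = 0], but [t q] may not vanish; the factor [c - t] gives orthogonality on both sides. *)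
pose p := (c - t) * q.
have tt : t * t = t by rewrite -{2}dt mulrA td dt.
have tp : t * p = 0 by rewrite mulrA mulrBr tt mulrBl -mulrA cq subrr.
have pt : p * t = 0 by rewrite -mulrA qt mulr0.
have pp : p * p = p.
  by rewrite {2}/p mulrA mulrBr pt subr0 -(mulrA p) cq /p -mulrA -{2}cq (mulrA q) qc eq.
exists (fun i => if i == k then (c - t) * (e * r * c * y k) else g i).
have gE i : i \in s -> i == k = false by move=> si; apply: contraNF ks => /eqP <-.
have pE : (c - t) * (e * r * c * y k) * x k = p by rewrite /p /q !mulrA.
have tE :
    \sum_(i <- s) (if i == k then (c - t) * (e * r * c * y k) else g i) * x i = t.
  by rewrite big_seq [RHS]big_seq; apply: eq_bigr => i /gE->.
have gt i : i \in s -> g i * x i * t = g i * x i /\ t * (g i * x i) = g i * x i.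
  move=> si; rewrite mulr_sumr mulr_suml !(bigD1_seq i) //= !gg // eqxx.
  split; rewrite big_seq_cond big1 ?addr0 // => j /andP[sj ji].
    by rewrite gg // eq_sym (negbTE ji).
  by rewrite gg // (negbTE ji).
split.
- move=> i j; rewrite !inE => /predU1P[->|si] /predU1P[->|sj].
  + by rewrite eqxx pE pp.
  + rewrite eqxx pE (gE j sj) eq_sym (gE j sj).
    by have [_ <-] := gt _ sj; rewrite mulrA pt mul0r.
  + rewrite eqxx pE (gE i si).
    by have [<- _] := gt _ si; rewrite -mulrA tp mulr0.
  + by rewrite (gE i si) (gE j sj) gg.
- by rewrite big_cons eqxx tE pE mulrDr ct /p mulrA mulrBr cc ct.
- rewrite big_cons eqxx tE pE mulrDl /p -mulrA qc mulrBl ce.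
  have -> : t * c = c - e + t * e by rewrite -[in LHS](subrK e c) mulrDr tce.
  by rewrite addrC addrACA subrK subrr addr0.
Qed.
End ExchangeRings.

(** * From exchange endomorphism rings to the finite exchange property *)

Section FiniteExchange.
Variable S : pzRingType.
Implicit Types A M X : lmodType S.

Lemma submod_closedB_in A (B : {pred A}) u v :
  GRing.submod_closed B -> u \in B -> v \in B -> u - v \in B.
Proof. by move=> clB; apply: (GRing.submod_closedB clB).2. Qed.

(** Components are picked by choice; uniqueness of decompositions makes them linear. *)
Lemma direct_sum_projections (I : finType) A (B : I -> {pred A}) :
    internal_direct_sum B ->
  exists rho : I -> {linear A -> A},
    [/\ forall i a, rho i a \in B i, forall a, \sum_i rho i a = a
      & forall i j a, a \in B j -> rho i a = if i == j then a else 0].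
Proof.
move=> [clB sumB uniqB].
have decomposes a : exists b : I -> A, (forall i, b i \in B i) /\ \sum_i b i = a.
  by have [b bB ->] := sumB a; exists b.
have [r rP] := choice decomposes.
have rE a b : (forall i, b i \in B i) -> \sum_i b i = a -> forall i, r a i = b i.
  move=> bB ba i; apply/eqP; rewrite -subr_eq0; apply/eqP.
  apply: (uniqB (fun i => r a i - b i)) => [j|].
    by apply: submod_closedB_in => //; case: (rP a).
  by rewrite sumrB ba (rP a).2 subrr.
have r_lin i : linear (r ^~ i).
  move=> c u v; apply: (rE _ (fun i => c *: r u i + r v i)) => [j|].
    by have [_] := clB j; apply; [case: (rP u)|case: (rP v)].
  by rewrite big_split /= -scaler_sumr !(rP _).2.
pose rho i : {linear A -> A} :=
  HB.pack (r ^~ i) (GRing.isLinear.Build _ _ _ _ _ (r_lin i)).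
exists rho; split=> [i a|a|i j a aB]; first exact: (rP a).1.
  exact: (rP a).2.
apply: (rE a (fun i => if i == j then a else 0)) => [k|].
  by case: eqP => [->//|_]; case: (clB k).
by rewrite -big_mkcond /= big_pred1_eq.
Qed.

Lemma EndRing_sumE (I : Type) (s : seq I) M (f : I -> EndRing M) x :
  (\sum_(i <- s) f i) x = \sum_(i <- s) f i x.
Proof. by elim/big_ind2: _ => // f1 y1 f2 y2 <- <-. Qed.

Lemma exchange_finite_exchange M : exchange_ring (EndRing M) -> finite_exchange M.
Proof.
move=> exM I A M' N A_ [iota iotaI iotaP] dMN dA.
have [rho [rhoA rho_sum rhoE]] := direct_sum_projections dA.
have [sg [sgM sg_sum sgE]] := direct_sum_projections dMN.
have [pi0 pi0P] : {f : A -> M & forall a, iota (f a) = sg true a}.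
  by apply: (@choice _ _ (fun a x => iota x = sg true a)) => a; apply/iotaP/(sgM true).
have pi_lin : linear pi0.
  by move=> c u v; apply: iotaI; rewrite linearP /= !pi0P linearP.
have [pi piP] : exists pi : {linear A -> M}, forall a, iota (pi a) = sg true a.
  pose pi : {linear A -> M} :=
    HB.pack pi0 (GRing.isLinear.Build _ _ _ _ _ pi_lin).
  by exists pi.
have piK x : pi (iota x) = x.
  by apply: iotaI; rewrite piP (sgE true true) //; apply/iotaP; exists x.
pose f i : EndRing M := pi \o rho i \o iota.
have f1 : 1 = \sum_i 1 * f i.
  under eq_bigr do rewrite mul1r.
  by apply: EndRing_ext => x; rewrite EndRing_sumE /= -linear_sum rho_sum piK.
have [g [gg _ t1]] :=
  exchange_orthogonal_idempotents exM (index_enum_uniq I) (mulr1 1) f1.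
rewrite mulr1 in t1.
(* This keeps the idempotents [g i * f i] and makes each of them fix [G i] from the left. *)
pose G i := g i * f i * g i.
have Gf i : G i * f i = g i * f i.
  by rewrite /G -mulrA gg ?mem_index_enum // eqxx.
have GfG i j x : G i (f i (G j x)) = if i == j then G j x else 0.
  have /(congr1 (fun h : EndRing M => h x)) :
      G i * f i * G j = if i == j then G j else 0.
    rewrite Gf {1}/G mulrA gg ?mem_index_enum //.
    by case: eqP => [->//|_]; rewrite mul0r.
  by case: eqP.
have G1 x : \sum_i G i (f i x) = x.
  rewrite -[RHS]/((1 : EndRing M) x) -t1 EndRing_sumE.
  by apply: eq_bigr => i _; rewrite -Gf.
have fE i x : f i x = pi (rho i (iota x)) by [].
clearbody G f; have theta_lin : linear (fun a => \sum_i G i (pi (rho i a))).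
  move=> c u v; rewrite scaler_sumr -big_split /=.
  by apply: eq_bigr => i _; rewrite !linearP.
have [theta thetaE] : exists theta : {linear A -> M},
    forall a, theta a = \sum_i G i (pi (rho i a)).
  pose theta : {linear A -> M} := HB.pack (fun a => \sum_i G i (pi (rho i a)))
    (GRing.isLinear.Build _ _ _ _ _ theta_lin).
  by exists theta.
have theta_iota x : theta (iota x) = x
  by rewrite thetaE -[RHS]G1; apply: eq_bigr => i _; rewrite fE.
(* Applying [G i \o f i] to [theta a] isolates its [i]-th term, so the components of an element of
   the kernel are in the kernel. *)
have theta0 a i : theta a = 0 -> G i (pi (rho i a)) = 0.
  rewrite thetaE => /(congr1 (fun x => G i (f i x))); rewrite !linear0 => <-.
  rewrite [f i _]linear_sum linear_sum (bigD1 i) //= big1 => [|j ji];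
    rewrite GfG ?eqxx ?addr0 //.
  by rewrite eq_sym (negbTE ji).
have sum_option (F : option I -> A) : \sum_o F o = F None + \sum_i F (Some i).
  rewrite (bigD1 None) //= (reindex_omap Some id) => [|[]//].
  by congr (_ + _); apply: eq_bigl => i; rewrite eqxx.
(* On [A_ i] the map [theta] is [G i \o pi], so [B i] is the kernel of [theta] inside [A_ i]. *)
pose B i : {pred A} := [pred a | (a \in A_ i) && (G i (pi a) == 0)].
exists B.
have [A_cl _ A_uniq] := dA; have [M_cl _ _] := dMN.
have B_cl i : GRing.submod_closed (B i).
  split; first by rewrite inE /= !linear0 eqxx andbT; case: (A_cl i).
  move=> c u v; rewrite !inE => /andP[uA /eqP u0] /andP[vA /eqP v0].
  by rewrite !linearP u0 v0 scaler0 addr0 eqxx andbT; case: (A_cl i) => _; apply.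
split=> // [i a /andP[]//|]; split.
- by case=> [i|]; [apply: B_cl|apply: (M_cl true)].
- move=> a; pose b o := if o is Some i then rho i (a - iota (theta a)) else iota (theta a).
  exists b; last by rewrite sum_option /= rho_sum addrC subrK.
  case=> [i|] /=; last by apply/iotaP; exists (theta a).
  by rewrite inE /= rhoA theta0 ?eqxx // linearB /= theta_iota subrr.
- move=> b bB; rewrite sum_option => b0.
  have thetab i : theta (b (Some i)) = 0.
    have /andP[bA /eqP Gb] := bB (Some i).
    rewrite thetaE (bigD1 i) //= (rhoE i i) // eqxx Gb add0r big1 // => j ji.
    by rewrite (rhoE j i) // (negbTE ji) !linear0.
  have bN : b None = 0.
    have /iotaP[x xb] := bB None.
    move/(congr1 theta): b0; rewrite linearD linear_sum /= big1 => [|i _]; last exact: thetab.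
    by rewrite linear0 addr0 -xb theta_iota => ->; rewrite linear0.
  case=> [i|//]; rewrite bN add0r in b0; apply: (A_uniq _ _ b0) => j.
  by case/andP: (bB (Some j)).
Qed.

End FiniteExchange.

(** * Cleanness passes from [End(X)/J] to [End(X)] and on to [End(M)] *)

Lemma clean_lift_modJ (R : pzRingType) :
  idempotents_lift_modJ R -> clean_ring (quotJ R) -> clean_ring R.
Proof.
move=> liftR cleanQ a; have [e0 [v0 [ee0 uv0 vu0]]] := cleanQ (modJ a).
have [e ee eE] := liftR e0 ee0; have [v vE] := modJ_surj v0.
(* Both products of [a - e] and [v] are [1] modulo the radical, hence units; the right inverse [v x]
   and the left inverse [y v] of [a - e] then coincide. *)
have [|x ux _] := @jacobson_unit R ((a - e) * v).
  by apply/modJ_eq; rewrite modJ_mul modJ_is_zmod_morphism eE vE; apply/esym/uv0.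
have [|y _ yu] := @jacobson_unit R (v * (a - e)).
  by apply/modJ_eq; rewrite modJ_mul modJ_is_zmod_morphism eE vE; apply/esym/vu0.
exists e, (v * x); split=> //; first by rewrite mulrA.
have -> : v * x = y * v; last by rewrite -mulrA.
by rewrite -[v]mul1r -{1}yu -!mulrA (mulrA (a - e)) ux mulr1 mul1r.
Qed.

Section CoinvariantModules.
Variable S : pzRingType.
Implicit Types M X : lmodType S.

Lemma bijective_linear_inverse X X' (f : {linear X -> X'}) : bijective f ->
  exists f' : {linear X' -> X}, cancel f f' /\ cancel f' f.
Proof.
move=> [f' fK f'K].
pose g : {linear X' -> X} :=
  HB.pack f' (GRing.isLinear.Build _ _ _ _ _ (can2_linear fK f'K)).
by exists g.
Qed.

(** Both composites of the comparison maps lie over [M], so they are automorphisms by the cover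
    property. *)
Lemma cover_iso (C : lmodType S -> Prop) M X X'
    (p : {linear X -> M}) (p' : {linear X' -> M}) :
    is_cover C p -> is_cover C p' ->
  exists2 f : {linear X -> X'}, bijective f & forall x, p' (f x) = p x.
Proof.
move=> [[CX pC] pE] [[CX' pC'] pE'].
have [f fP] := pC' _ p CX; have [h hP] := pC _ p' CX'.
have [k hfK khfK] : bijective (h \o f) by apply: pE => x /=; rewrite hP fP.
have [l fhK lfhK] : bijective (f \o h) by apply: pE' => x /=; rewrite fP hP.
have fI : injective f by move=> x y fxy; apply: (can_inj hfK); rewrite /= fxy.
exists f => //; exists (h \o l) => x; last exact: lfhK.
by apply: fI; apply: lfhK.
Qed.

(** Coinvariance is witnessed by one cover only; automorphisms of another are conjugated along the
    isomorphism over [M]. *)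
Lemma coinvariant_cover (C : lmodType S -> Prop) M X (p : {linear X -> M})
    (g : {linear X -> X}) :
  automorphism_coinvariant C M -> is_cover C p -> bijective g ->
  exists f : {linear M -> M}, forall x, f (p x) = p (g x).
Proof.
move=> [X' [p' cp' Mp']] cp g_bij; have [f f_bij fP] := cover_iso cp cp'.
have [f' [fK f'K]] := bijective_linear_inverse f_bij.
have [|k kP] := Mp' (f \o g \o f').
  by apply: bij_comp; [apply: bij_comp|exists f].
by exists k => x; rewrite -fP kP /= fK fP.
Qed.

Lemma coinvariant_clean (C : lmodType S -> Prop) M X (p : {linear X -> M}) :
    is_cover C p -> is_epi p -> automorphism_coinvariant C M ->
  clean_ring (EndRing X) -> clean_ring (EndRing M).
Proof.
move=> cp ep Mc cleanX a; have [[CX pC] _] := cp.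
have [s sP] := pC _ (a \o p : {linear X -> M}) CX.
have [e [v [ee uv vu]]] := cleanX s.
pose u : EndRing X := (s : EndRing X) - e; rewrite -/u in uv vu.
have uvx x : u (v x) = x by rewrite -[RHS]/((1 : EndRing X) x) -uv.
have vux x : v (u x) = x by rewrite -[RHS]/((1 : EndRing X) x) -vu.
(* Both [u] and its inverse [v] descend, so the map induced by [u] is invertible on [M]. *)
have [u' u'P] : exists f : {linear M -> M}, forall x, f (p x) = p (u x).
  by apply: (coinvariant_cover Mc cp); exists v.
have [v' v'P] : exists f : {linear M -> M}, forall x, f (p x) = p (v x).
  by apply: (coinvariant_cover Mc cp); exists u.
pose U : EndRing M := u'; pose V : EndRing M := v'.
have UV : U * V = 1.
  by apply: EndRing_ext => m; have [x <-] := ep m; rewrite /= v'P u'P uvx.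
have VU : V * U = 1.
  by apply: EndRing_ext => m; have [x <-] := ep m; rewrite /= u'P v'P vux.
(* [e] need not be an automorphism; it descends as the difference of [s] and [u], which induce [a]
   and [U]. *)
have eP x : (a - U) (p x) = p (e x).
  have -> : (a - U) (p x) = a (p x) - u' (p x) by [].
  rewrite u'P -[a _]sP -linearB; congr (p _).
  by rewrite -[s x - u x]/(((s : EndRing X) - u) x) /u subKr.
exists (a - U), V; rewrite subKr; split=> //.
apply: EndRing_ext => m; have [x <-] := ep m.
by rewrite -[LHS]/((a - U) ((a - U) (p x))) !eP -[e (e x)]/((e * e) x) ee.
Qed.

End CoinvariantModules.

Theorem corollary4p7 (R : pzRingType) (C : rmodType R -> Prop)
    (C_iso : iso_closed C) (M X : rmodType R) (p : {linear X -> M})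
    (p_cover : is_cover C p) (p_epi : is_epi p)
    (regJ : von_neumann_regular (quotJ (EndRing X)))
    (injJ : right_self_injective (quotJ (EndRing X)))
    (liftJ : idempotents_lift_modJ (EndRing X))
    (M_coinv : automorphism_coinvariant C M) :
  finite_exchange M.
Proof.
apply/exchange_finite_exchange/clean_exchange.
apply: (coinvariant_clean p_cover p_epi M_coinv).
exact: clean_lift_modJ liftJ (regular_self_injective_clean regJ injJ).
Qed.
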